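(* Let $F\subseteq\bar{\mathbb{Q}}$ be a field with Northcott number $\mathcal{N}(F)=C$, and let $d\geq 1$ be an integer. Then the set $X$ of algebraic numbers of degree $\le d$ over $F$ satisfies $$\mathcal{N}(X)\ge\frac{C-d\log 2}{d2^d}.$$
   Context: Let $\bar{\mathbb{Q}}$ be an algebraic closure of $\mathbb{Q}$ and $h:\bar{\mathbb{Q}}\to[0,\infty)$ the absolute logarithmic Weil height. For $S\subseteq\bar{\mathbb{Q}}$ the Northcott number is $\mathcal{N}(S)=\inf\{t\in[0,\infty):\#\{\alpha\in S: h(\alpha)<t\}=\infty\}\in[0,\infty]$, with $\inf\emptyset=\infty$. If $C=\infty$ the right-hand side is read as $\infty$. *)

(* Defs.v *)
From HB Require Import structures.
From mathcomp Require Import all_boot all_order all_algebra all_field.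
From mathcomp Require Import all_classical all_reals all_analysis.

Set Implicit Arguments.
Unset Strict Implicit.
Unset Printing Implicit Defensive.

Import Order.TTheory GRing.Theory Num.Theory.

Local Open Scope classical_set_scope.
Local Open Scope ring_scope.

(* The algebraic closure of Q is algC.

   The absolute logarithmic Weil height of alpha, with K = Q(alpha), is
     h(alpha) = 1/[K:Q] * sum_v [K_v:Q_v] log max(1, |alpha|_v),
   v ranging over the places of K and |.|_v extending the usual absolute value
   |.|_p of Q, p <= oo.  Fix an extension of |.|_p to algC.  The places v of K
   above p are the x |-> |s(x)|_p for s an embedding of K into algC, and exactly
   [K_v:Q_v] embeddings s induce a given v, so the sum over the places above p
   is the sum over s of log max(1, |s(alpha)|_p).  The numbers s(alpha) are the
   distinct roots of the minimal polynomial of alpha over Q, and [K:Q] is its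
   degree. *)

Section Height.
Variable R : realType.

(* algC is not ordered by R and its norm takes values in algC: a real algebraic
   number is sent to R as the supremum of the rationals below it. *)
Definition algC_to_real (x : algC) : R :=
  sup [set ratr q | q in [set q : rat | (ratr q : algC) <= x]].

Definition arch_abs (x : algC) : R := algC_to_real `|x|.

(* |q|_p = p ^ (- v_p(q)) *)
Definition padic_abs_rat (p : nat) (q : rat) : R :=
  if q == 0 then 0
  else p%:R ^ ((logn p `|denq q|%N)%:Z - (logn p `|numq q|%N)%:Z).

Definition is_padic_extension (p : nat) (v : algC -> R) : Prop :=
  [/\ forall x, 0 <= v x,
      forall x, v x = 0 <-> x = 0,
      forall x y, v (x * y) = v x * v y,
      forall x y, v (x + y) <= Num.max (v x) (v y) &
      forall q : rat, v (ratr q) = padic_abs_rat p q].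

(* Extensions exist by Chevalley's extension theorem.  Two of them differ by an
   automorphism of algC, so the sums over conjugates below do not depend on the
   choice made here. *)
Definition padic_abs (p : nat) : algC -> R :=
  xget (fun=> 0) [set v | is_padic_extension p v].

Definition logmax1 (r : R) : R := ln (Num.max 1 r).

Definition conjugates (a : algC) : set algC := [set b | root (minCpoly a) b].

(* For each b, |b|_p <= 1 for all but finitely many primes p, so the inner sum
   has finite support. *)
Definition weil_height (a : algC) : R :=
  (size (minCpoly a)).-1%:R^-1 *
  \sum_(b \in conjugates a)
     (logmax1 (arch_abs b) +
      \sum_(p \in [set p : nat | prime p]) logmax1 (padic_abs p b)).

Definition northcott_number (S : set algC) : \bar R :=
  ereal_inf [set t%:E | t in
    [set t : R | 0 <= t /\ infinite_set [set a | S a /\ weil_height a < t]]].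

End Height.

(* Minimal polynomial of a over the subfield F of algC. *)
Definition is_min_poly (F : divringClosed algC) (a : algC) (P : {poly algC}) :
    Prop :=
  [/\ P \is a polyOver F, P \is monic, root P a &
      forall Q : {poly algC}, Q \is a polyOver F -> Q != 0 -> root Q a ->
        (size P <= size Q)%N].

Definition degree_le_over (F : divringClosed algC) (d : nat) : set algC :=
  [set a | exists2 P, is_min_poly F a P & ((size P).-1 <= d)%N].

(* Main.v *)
From HB Require Import structures.
Require Import Defs.
From mathcomp Require Import all_boot all_order all_algebra all_field.
From mathcomp Require Import all_classical all_reals all_analysis.
From mathcomp Require Import ring lra.

Set Implicit Arguments.
Unset Strict Implicit.
Unset Printing Implicit Defensive.

Import Order.TTheory GRing.Theory Num.Theory.

Local Open Scope classical_set_scope.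
Local Open Scope ring_scope.

(** Let a be of degree at most d over F, with minimal polynomial P over F.
    Since P divides the minimal polynomial of a over Q ([is_min_poly_dvdp]), its
    roots c_1, ..., c_e are conjugates of a over Q, so they all have the height
    of a.  Each coefficient of P is a signed elementary symmetric function of
    the c_j.  At every place it is bounded by the product of the max(1, |c_j|),
    up to a factor 2^e at the archimedean one, and averaging over the places
    gives
      h(P_k) <= e log 2 + h(c_1) + ... + h(c_e) <= d (log 2 + h(a))
    ([weil_height_coef], [weil_height_min_poly_coef]).

    If infinitely many such a had height below t while only finitely many
    elements of F had height below d (log 2 + t), then all these a would be
    roots of polynomials of degree at most d with coefficients in a fixed finite
    set, and there are finitely many such roots.  Hence
      N(F) <= d log 2 + d N(X)
    ([northcott_number_le_linear]), and the theorem follows because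
    N(X) <= 2^d N(X).

    The height of x is an average over the conjugates of x, so the heights of
    the P_k and of the c_j are averages over different sets.  To compare them
    place by place, both are rewritten as averages over one finite family of
    automorphisms of algC, which stands for the Galois group of a number field
    containing all these numbers ([weil_height_average]).

    The p-adic absolute value in the height is obtained by choice, with the zero
    function as default.  The zero function satisfies the same inequalities as
    an extension of the p-adic absolute value, so the local estimates cover both
    outcomes of the choice ([padic_quasi_abs], [padic_abs_le1]). *)

(** * Automorphisms of algC and conjugates *)

(** The roots of the minimal polynomial of x generate a normal number field.
    Its Galois group is transitive on them, and its elements extend to algC. *)
Lemma conjugate_automorphism (x y : algC) : root (minCpoly x) y ->
  exists nu : {rmorphism algC -> algC}, nu x = y.
Proof.
move=> xy.
have [r Dr] := closed_field_poly_normal (minCpoly x).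
rewrite (monicP (minCpoly_monic x)) scale1r in Dr.
have [Qs [QsC [s1 Ds1 gen]]] := num_field_exists r.
have Dmap: map_poly QsC (\prod_(z <- s1) ('X - z%:P)) = minCpoly x.
  rewrite Dr -Ds1 big_map rmorph_prod; apply: eq_bigr => z _ /=.
  by rewrite map_polyXsubC.
have [q [Dq q_monic] dvq] := minCpolyP x.
have Dq1 : \prod_(z <- s1) ('X - z%:P) = map_poly (in_alg Qs) q.
  apply: (map_poly_inj QsC); rewrite Dmap Dq -map_poly_comp.
  by apply: eq_map_poly => a /=; rewrite alg_num_field fmorph_rat.
have ax : SplittingField.axiom Qs.
  exists (map_poly (in_alg Qs) q); first exact: alg_polyOver.
  by exists s1 => //; rewrite Dq1 eqpxx.
pose LM := FieldExt_isSplittingField.Build rat Qs ax.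
pose L : splittingFieldType rat := HB.pack (FieldExt.sort Qs) LM.
have lift z : root (minCpoly x) z -> exists2 u, u \in s1 & QsC u = z.
  rewrite Dr root_prod_XsubC -Ds1 => /mapP [u us ->].
  by exists u.
have [u us Du] := lift x (root_minCpoly x).
have [w ws Dw] := lift y xy.
(* The minimal polynomial of u vanishes at x, so that of x divides it. *)
have pw : root (minPoly (1%AS : {subfield L}) (u : L)) (w : L).
  have [p Dp] := polyOver1P (minPolyOver (1%AS : {subfield L}) (u : L)).
  have : root (map_poly (ratr : rat -> algC) p) x.
    have := root_minPoly (1%AS : {subfield L}) (u : L); rewrite Dp.
    rewrite -(fmorph_root QsC) -map_poly_comp Du; congr (root _ _).
    by apply: eq_map_poly => a /=; rewrite alg_num_field fmorph_rat.
  rewrite dvq Dp => /dvdpP [h ->]; rewrite rmorphM rootM; apply/orP; right.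
  by move: ws; rewrite -root_prod_XsubC Dq1.
have nL := normalFieldf (1%AS : {subfield L}).
have [g _ Dg] := normalField_root_minPoly (sub1v _) nL (memvf _) pw.
have [nu Dnu] := @extend_algC_subfield_aut Qs QsC g.
by exists nu; rewrite -Du -Dnu -Dw; congr (QsC _).
Qed.

Lemma root_minCpoly_aut (nu : {rmorphism algC -> algC}) (x y : algC) :
  root (minCpoly x) (nu y) = root (minCpoly x) y.
Proof.
have [q [Dq _] _] := minCpolyP x.
rewrite -[in RHS](fmorph_root nu) Dq -map_poly_comp.
by congr (root _ _); apply: eq_map_poly => a /=; rewrite fmorph_rat.
Qed.

(** With t a primitive element for s, the family has one automorphism for each
    conjugate of t, sending t to it.  For x = g(t), the values nu(x) are the
    g(u) with u a conjugate of t.  All fibres of u |-> g(u) over the conjugates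
    of x have the same size m, because an automorphism sending x to a given
    conjugate permutes the conjugates of t and so carries one fibre onto the
    other. *)
Lemma automorphisms_average_conjugates (s : seq algC) :
  exists N : seq {rmorphism algC -> algC}, (0 < size N)%N /\
   forall x, x \in s -> forall (V : zmodType) (phi : algC -> V) (r : seq algC),
     uniq r -> (forall y, (y \in r) = root (minCpoly x) y) ->
     exists m : nat, (size N = m * size r)%N /\
       \sum_(nu <- N) phi (nu x) = (\sum_(y <- r) phi y) *+ m.
Proof.
have [t _ [ps Ds]] := algC_PET s.
have [T0 DT0] := closed_field_poly_normal (minCpoly t).
pose T := undup T0.
have memT y : (y \in T) = root (minCpoly t) y.
  by rewrite mem_undup DT0 (monicP (minCpoly_monic t)) scale1r root_prod_XsubC.
have uT : uniq T := undup_uniq _.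
have [N DN] : exists N : seq {rmorphism algC -> algC},
    [seq nu t | nu : {rmorphism algC -> algC} <- N] = T.
  have: {subset T <= root (minCpoly t)} by move=> y; rewrite memT.
  elim: (T) => [|y T1 IH] sT; first by exists [::].
  have [|N1 <-] := IH; first by move=> z zT; apply: sT; rewrite inE zT orbT.
  have [|nu <-] := @conjugate_automorphism t y.
    by apply: sT; rewrite mem_head.
  by exists (nu :: N1).
have sN : size N = size T by rewrite -DN size_map.
exists N; split.
  by rewrite sN -has_predT; apply/hasP; exists t; rewrite ?memT ?root_minCpoly.
move=> x xs V phi r ur memr.
have [g Dx] : exists g : {poly rat}, x = (map_poly ratr g).[t].
  by move: xs; rewrite Ds => /mapP [g _ ->]; exists g.
have gnu (nu : {rmorphism algC -> algC}) u :
    nu (map_poly ratr g).[u] = (map_poly ratr g).[nu u].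
  rewrite -horner_map -map_poly_comp; congr (horner _ _).
  by apply: eq_map_poly => a /=; rewrite fmorph_rat.
pose G u : algC := (map_poly ratr g).[u].
have sumT (W : zmodType) (f : algC -> W) :
    \sum_(nu <- N) f (nu x) = \sum_(u <- T) f (G u).
  by rewrite -DN big_map; apply: eq_bigr => nu _; rewrite Dx gnu.
have Gr u : u \in T -> G u \in r.
  rewrite memT => /conjugate_automorphism [nu <-]; rewrite /G -gnu -Dx memr.
  by rewrite -(minCpoly_aut nu) root_minCpoly.
pose m := count (fun u => G u == x) T.
have fib y : y \in r -> count (fun u => G u == y) T = m.
  rewrite memr => /conjugate_automorphism [mu <-].
  have /seq.permP <- : perm_eq [seq mu u | u <- T] T.
    apply: uniq_perm => //; first by rewrite map_inj_uniq //; apply: fmorph_inj.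
    move=> z; rewrite memT -[z](algC_invautK mu) (mem_map (fmorph_inj mu)).
    by rewrite !memT root_minCpoly_aut.
  rewrite count_map; apply: eq_count => u /=.
  by rewrite /G -gnu (inj_eq (fmorph_inj mu)).
have sumG (W : zmodType) (f : algC -> W) :
    \sum_(u <- T) f (G u) = (\sum_(y <- r) f y) *+ m.
  transitivity (\sum_(u <- T) \sum_(y <- r | y == G u) f y).
    rewrite !big_seq; apply: eq_bigr => u uT'.
    by rewrite -(big_filter r) filter_pred1_uniq ?Gr // big_seq1.
  rewrite (exchange_big_dep xpredT) //= -sumrMnl.
  rewrite !big_seq; apply: eq_bigr => y yr.
  rewrite -(fib y yr) big_const_seq iter_addr_0; congr (_ *+ _).
  by apply: eq_count => u; rewrite /= eq_sym.
exists m; split; last by rewrite sumT sumG.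
(* Counting is summing the constant function 1. *)
have := sumG int (fun=> 1); rewrite !big_const_seq !count_predT !iter_addr_0.
by rewrite -mulrnA => /eqP; rewrite eqr_nat sN mulnC => /eqP.
Qed.

(** Separability in characteristic 0: the minimal polynomial is irreducible over
    Q and its derivative is nonzero of smaller degree. *)
Lemma minCpoly_prod_conjugates (x : algC) :
  exists2 r : seq algC, uniq r & minCpoly x = \prod_(y <- r) ('X - y%:P).
Proof.
have [r Dr] := closed_field_poly_normal (minCpoly x).
rewrite (monicP (minCpoly_monic x)) scale1r in Dr.
exists r => //; rewrite -separable_prod_XsubC -Dr.
have [q [Dq q_monic] dvq] := minCpolyP x.
have q0 : q != 0 by apply: monic_neq0.
have rx : root (map_poly ratr q : {poly algC}) x by rewrite -Dq root_minCpoly.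
have irr : irreducible_poly q.
  by apply/(subfx_irreducibleP rx q0) => u ux u0; rewrite dvdp_leq // -dvq.
rewrite Dq separable_map unlock irreducible_poly_coprime //.
have dq0 : q^`() != 0.
  have sq : (1 < size q)%N by have := size_minCpoly x; rewrite Dq size_map_poly.
  apply/negP => /eqP /polyP /(_ (size q).-2); rewrite coef_deriv coef0.
  have -> : (size q).-2.+1 = (size q).-1 by case: (size q) sq => [|[]].
  rewrite -lead_coefE (monicP q_monic) => /eqP; rewrite pnatr_eq0.
  by case: (size q) sq => [|[]].
by rewrite gtNdvdp // lt_size_deriv.
Qed.

(** * The archimedean absolute value *)

Section Arch.
Context (R : realType).
Local Notation rho := (@algC_to_real R).

Lemma rational_le_algC_to_real (q : rat) (x : algC) :
  ratr q <= x -> ratr q <= rho x.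
Proof.
move=> qx; apply: ub_le_sup; last by exists q.
have xR : x \is Num.real by rewrite -(ler_real qx) Creal_Crat ?Crat_rat.
exists (Num.bound `|x|)%:R => _ [r rx <-].
rewrite -(ratr_nat R) ler_rat -(ler_rat algC) ratr_nat.
apply: le_trans rx (le_trans (real_ler_norm xR) (ltW _)).
exact: archi_boundP.
Qed.

Lemma rational_lt_algC_to_real (q : rat) (x : algC) : x \is Num.real ->
  rho x < ratr q -> x < ratr q.
Proof.
move=> xR; rewrite ltNge => xq.
rewrite real_ltNge //; last exact/Creal_Crat/Crat_rat.
by apply: contra xq => /rational_le_algC_to_real.
Qed.

Lemma algC_to_real_le (x : algC) (r : R) : 0 <= x ->
  (forall q : rat, ratr q <= x -> ratr q <= r) -> rho x <= r.
Proof.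
move=> x0 H; apply: ge_sup; last by move=> _ [q qx <-]; apply: H.
by exists (ratr 0); exists 0 => //=; rewrite rmorph0.
Qed.

Lemma le_algC_to_real (x y : algC) : 0 <= x -> x <= y -> rho x <= rho y.
Proof.
move=> x0 xy; apply: algC_to_real_le => // q qx.
by apply: rational_le_algC_to_real; apply: le_trans qx xy.
Qed.

Lemma algC_to_real_ge0 (x : algC) : 0 <= x -> 0 <= rho x.
Proof. by have := @rational_le_algC_to_real 0 x; rewrite !rmorph0. Qed.

(** A rational q <= x + y exceeding rho x + rho y splits as q1 + (q - q1) with
    q1 > rho x and q - q1 > rho y; then q1 > x and q - q1 > y, which is
    absurd. *)
Lemma algC_to_realD (x y : algC) : 0 <= x -> 0 <= y ->
  rho (x + y) <= rho x + rho y.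
Proof.
move=> x0 y0; apply: algC_to_real_le; first exact: addr_ge0.
move=> q qxy; rewrite leNgt; apply/negP => lt.
rewrite -ltrBrDr in lt.
have [q1] := rat_in_itvoo lt.
rewrite in_itv /= => /andP [q1x q1y].
have q1x' := rational_lt_algC_to_real (ger0_real x0) q1x.
have : y < ratr (q - q1).
  apply: rational_lt_algC_to_real; first exact: ger0_real.
  by rewrite rmorphB /= ltrBrDl -ltrBrDr.
rewrite rmorphB /= ltrBrDl => H.
have H3 : x + y < ratr q1 + y by rewrite ltrD2r.
by have := le_lt_trans qxy (lt_trans H3 H); rewrite ltxx.
Qed.

(** A rational q <= x * y satisfies q / q2 <= x for each rational q2 above
    rho y, hence q <= rho x * q2; now let q2 decrease to rho y. *)
Lemma algC_to_realM (x y : algC) : 0 <= x -> 0 <= y ->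
  rho (x * y) <= rho x * rho y.
Proof.
move=> x0 y0; apply: algC_to_real_le; first exact: mulr_ge0.
move=> q qxy.
have rx0 := algC_to_real_ge0 x0; have ry0 := algC_to_real_ge0 y0.
have key (q2 : rat) : rho y < ratr q2 -> ratr q <= rho x * ratr q2.
  move=> yq2.
  have q2R : 0 < ratr q2 :> R by apply: le_lt_trans yq2.
  have q20 : 0 < q2 by rewrite -(ltr_rat R) rmorph0.
  rewrite -ler_pdivrMr // -fmorph_div; apply: rational_le_algC_to_real.
  rewrite fmorph_div ler_pdivrMr ?ltr0q //; apply: le_trans qxy _.
  by rewrite ler_wpM2l // ltW // rational_lt_algC_to_real // ger0_real.
rewrite leNgt; apply/negP => lt.
have [rx_eq0|rx_neq0] := eqVneq (rho x) 0.
  have [|q2] := @rat_in_itvoo R (rho y) (rho y + 1); first by rewrite ltrDl.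
  rewrite in_itv /= => /andP [/key yq2 _].
  by move: lt yq2; rewrite rx_eq0 !mul0r ltNge => /negP.
have rx_gt0 : 0 < rho x by rewrite lt_def rx_neq0.
have [|q2] := @rat_in_itvoo R (rho y) (ratr q / rho x).
  by rewrite ltr_pdivlMr // mulrC.
rewrite in_itv /= => /andP [/key yq2 ].
by rewrite ltr_pdivlMr // mulrC ltNge yq2.
Qed.

Lemma algC_to_real1 : rho 1 = 1.
Proof.
apply/eqP; rewrite eq_le; apply/andP; split.
  apply: algC_to_real_le => // q.
  by rewrite -(rmorph1 (ratr : rat -> algC)) ler_rat -(ler_rat R) rmorph1.
by have := @rational_le_algC_to_real 1 1; rewrite !rmorph1; apply.
Qed.

Lemma arch_abs_ge0 (x : algC) : 0 <= arch_abs R x.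
Proof. exact: algC_to_real_ge0. Qed.

Lemma arch_abs1 : arch_abs R 1 = 1.
Proof. by rewrite /arch_abs normr1 algC_to_real1. Qed.

Lemma arch_absM (x y : algC) :
  arch_abs R (x * y) <= arch_abs R x * arch_abs R y.
Proof. by rewrite /arch_abs normrM algC_to_realM. Qed.

Lemma arch_absB (x y : algC) :
  arch_abs R (x - y) <= arch_abs R x + arch_abs R y.
Proof.
apply: le_trans (algC_to_realD _ _) => //.
by apply: le_algC_to_real => //; apply: ler_normB.
Qed.

Lemma arch_abs0 : arch_abs R 0 = 0.
Proof.
apply/eqP; rewrite eq_le arch_abs_ge0 andbT /arch_abs normr0.
apply: algC_to_real_le => // q.
by rewrite -(rmorph0 (ratr : rat -> algC)) ler_rat -(ler_rat R) rmorph0.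
Qed.

End Arch.

(** * Local heights *)

Section Local.
Context (R : realType).

Lemma logmax1_ge0 (r : R) : 0 <= logmax1 r.
Proof. by rewrite ln_ge0 // le_max lexx. Qed.

Lemma logmax1_le (r r' : R) : r <= r' -> logmax1 r <= logmax1 r'.
Proof.
move=> rr'; rewrite ler_ln ?posrE ?lt_max ?ltr01 //.
by rewrite ge_max !le_max lexx rr' orbT.
Qed.

Lemma logmax1_le1 (r : R) : r <= 1 -> logmax1 r = 0.
Proof. by move=> r1; rewrite /logmax1 max_l // ln1. Qed.

(** One form for the triangle inequality (A = 2) and the ultrametric one (A = 1),
    weak enough to hold for the zero function as well. *)
Record quasi_abs (A : R) (v : algC -> R) : Prop := QuasiAbs {
  quasi_abs_ge0 : forall x, 0 <= v x;
  quasi_abs0 : v 0 = 0;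
  quasi_abs1 : v 1 <= 1;
  quasi_absM : forall x y, v (x * y) <= v x * v y;
  quasi_absB : forall x y, v (x - y) <= A * Num.max (v x) (v y) }.

(** Multiplying Q by X - c turns the coefficients of Q into Q_(k-1) - c Q_k, of
    absolute value at most A max(1, |c|) times a bound for those of Q. *)
Lemma logmax1_coef_prod (A : R) (v : algC -> R) (s : seq algC) (k : nat) :
  1 <= A -> quasi_abs A v ->
  logmax1 (v (\prod_(c <- s) ('X - c%:P))`_k)
    <= ln A *+ size s + \sum_(c <- s) logmax1 (v c).
Proof.
move=> A1 [v0 v00 v1 vM vB].
have A0 : 0 < A by apply: lt_le_trans A1.
pose M := A ^+ size s * \prod_(c <- s) Num.max 1 (v c).
have maxgt0 c : 0 < Num.max 1 (v c) by rewrite lt_max ltr01.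
have prod_gt0 (s' : seq algC) : 0 < \prod_(c <- s') Num.max 1 (v c).
  by apply: prodr_gt0.
have M1 : 1 <= M.
  rewrite -[1]mulr1 ler_pM // ?exprn_ege1 //.
  apply: (big_ind (fun z : R => 1 <= z)) => // [z z'|c _].
    exact: mulr_ege1.
  by rewrite le_max lexx.
have bound : v (\prod_(c <- s) ('X - c%:P))`_k <= M.
  rewrite /M; elim: s k {M M1} => [|c s IH] k.
    rewrite !big_nil expr0 mulr1 coef1; case: (k == 0)%N; rewrite ?v00 //.
  rewrite !big_cons /= exprS.
  set Q := \prod_(c <- s) _; set P := \prod_(c <- s) _.
  have -> : A * A ^+ size s * (Num.max 1 (v c) * P)
    = A * (Num.max 1 (v c) * (A ^+ size s * P)) by ring.
  have B0 : 0 <= A ^+ size s * P by rewrite mulr_ge0 ?exprn_ge0 // ltW ?prod_gt0.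
  rewrite mulrBl coefB coefXM coefCM.
  apply: le_trans (vB _ _) _; rewrite ler_pM2l // ge_max; apply/andP; split.
    case: ifP => _; first by rewrite v00 mulr_ge0 // ltW.
    apply: le_trans (IH _) _; rewrite ler_peMl // le_max lexx //.
  apply: le_trans (vM _ _) _; apply: ler_pM => //; by rewrite le_max lexx orbT.
apply: le_trans (logmax1_le bound) _.
rewrite /logmax1 max_r // /M lnM ?posrE ?exprn_gt0 // lnXn // lerD2l.
rewrite le_eqVlt; apply/orP; left; apply/eqP.
elim: (s) => [|c s' IH]; first by rewrite !big_nil ln1.
by rewrite !big_cons lnM ?posrE // IH.
Qed.

Lemma arch_quasi_abs : quasi_abs 2 (arch_abs R).
Proof.
split; [exact: arch_abs_ge0|exact: arch_abs0|by rewrite arch_abs1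
       |exact: arch_absM|move=> x y].
apply: le_trans (arch_absB _ _ _) _.
by rewrite mulr_natl mulr2n lerD // le_max lexx ?orbT.
Qed.

Lemma is_padic_extension_N1 p (v : algC -> R) :
  is_padic_extension p v -> v 1 = 1 /\ v (-1) = 1.
Proof.
case=> v0 v00 vM vD vQ.
have v1 : v 1 = 1.
  apply: (@mulIf _ (v 1)); last by rewrite mul1r -vM mulr1.
  by apply/negP => /eqP /v00 /eqP; rewrite oner_eq0.
split=> //; apply/eqP; rewrite -(@eqrXn2 _ 2) // expr1n expr2 -vM.
by rewrite mulrNN mulr1 v1.
Qed.

Lemma padic_abs_spec p :
  padic_abs R p = (fun=> 0) \/ is_padic_extension p (padic_abs R p).
Proof. by rewrite /padic_abs; case: xgetP => [v _ h|_]; [right|left]. Qed.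

Lemma padic_quasi_abs p : quasi_abs 1 (padic_abs R p).
Proof.
have [->|ext] := padic_abs_spec p.
  by split=> *; rewrite ?mulr0 ?mul1r ?maxxx //.
have [v1 vN1] := is_padic_extension_N1 ext.
case: ext => v0 v00 vM vD vQ; split => //.
- by apply/v00.
- by rewrite v1.
- by move=> x y; rewrite vM.
- move=> x y; rewrite mul1r; apply: le_trans (vD _ _) _.
  by rewrite -mulN1r vM vN1 mul1r.
Qed.

Lemma ultrametric_sum_le (v : algC -> R) (B : R) n (F : 'I_n -> algC) :
  quasi_abs 1 v -> 0 <= B -> (forall i, v (F i) <= B) -> v (\sum_i F i) <= B.
Proof.
move=> [v0 v00 v1 vM vB] B0 FB; apply: (big_ind (fun z => v z <= B)) => //.
  by rewrite v00.
move=> x y xB yB; rewrite -[y]opprK; apply: le_trans (vB _ _) _.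
rewrite mul1r ge_max xB -sub0r; apply: le_trans (vB _ _) _.
by rewrite mul1r v00 ge_max B0.
Qed.

Lemma padic_abs_le1_rat p (q : rat) :
  prime p -> (`|denq q| < p)%N -> padic_abs R p (ratr q) <= 1.
Proof.
move=> pr dp; have [->//|[_ _ _ _ ->]] := padic_abs_spec p.
rewrite /padic_abs_rat; case: eqP => // _.
rewrite lognE (gtnNdvd _ dp) ?absz_gt0 ?denq_neq0 // andbF andbF sub0r.
rewrite -exprnN invf_le1 ?exprn_gt0 ?ltr0n ?prime_gt0 //.
by rewrite exprn_ege1 // ler1n prime_gt0.
Qed.

(** The minimal polynomial of b is monic over Z_(p) as soon as p exceeds all the
    denominators of its coefficients, and then |b|_p > 1 would make the leading
    term dominate the others. *)
Lemma padic_abs_le1 (b : algC) :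
  exists N : nat, forall p, prime p -> (N <= p)%N -> padic_abs R p b <= 1.
Proof.
have [q [Dq q_monic] dvq] := minCpolyP b.
have : root (map_poly ratr q : {poly algC}) b by rewrite -Dq root_minCpoly.
pose n := (size q).-1.
have sq : size q = n.+1.
  rewrite prednK // lt0n size_poly_eq0; exact: monic_neq0.
have n0 : (0 < n)%N.
  by have := size_minCpoly b; rewrite Dq size_map_poly sq ltnS.
rewrite rootE horner_coef size_map_poly sq big_ord_recr /=.
rewrite coef_map /= /n -lead_coefE (monicP q_monic) rmorph1 mul1r -/n => /eqP Db.
exists (\max_(i < n) `|denq q`_i|).+1 => p pr Np.
have Qp := padic_quasi_abs p; set v := padic_abs R p in Qp *.
rewrite leNgt; apply/negP => b1.
have vX m : v (b ^+ m) = v b ^+ m.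
  rewrite /v; have [E|ext] := padic_abs_spec p.
    by move: b1; rewrite /v E ltNge ler01.
  have [v1 _] := is_padic_extension_N1 ext.
  case: ext => _ _ vM _ _.
  by elim: m => [|m IH]; rewrite ?expr0 // !exprS vM IH.
have : v (b ^+ n) <= v b ^+ n.-1.
  have -> : b ^+ n = 0 - \sum_(i < n) (map_poly ratr q)`_i * b ^+ i.
    by apply/eqP; rewrite sub0r -addr_eq0 addrC Db.
  apply: le_trans (quasi_absB Qp _ _) _; rewrite mul1r (quasi_abs0 Qp) ge_max.
  have B0 : 0 <= v b ^+ n.-1 by rewrite exprn_ge0 // (quasi_abs_ge0 Qp).
  rewrite B0; apply: ultrametric_sum_le => // i.
  apply: le_trans (quasi_absM Qp _ _) _; rewrite -[leRHS]mul1r.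
  apply: ler_pM; rewrite ?(quasi_abs_ge0 Qp) //.
    rewrite coef_map; apply: padic_abs_le1_rat => //.
    apply: leq_trans Np; rewrite ltnS.
    exact: (@leq_bigmax 'I_n (fun j => `|denq q`_j|%N) i).
  by rewrite vX ler_weXn2l ?ltW // -ltnS prednK.
rewrite vX leNgt -{2}(prednK n0) => /negP; apply.
by rewrite ltr_eXn2l.
Qed.

(** Unlike the height, this depends on b and not only on its conjugacy class:
    above each place of Q it sees only the place of Q(b) given by the fixed
    absolute value of algC. *)
Definition local_height (b : algC) : R :=
  logmax1 (arch_abs R b) +
  \sum_(p \in [set p : nat | prime p]) logmax1 (padic_abs R p b).

(** A list of primes common to all elements of s turns the sums over all primes
    into ordinary finite sums, which can be split and exchanged. *)
Lemma padic_sum_finite (s : seq algC) :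
  exists r : seq nat, forall b, b \in s ->
    \sum_(p \in [set p : nat | prime p]) logmax1 (padic_abs R p b)
      = \sum_(p <- r) logmax1 (padic_abs R p b).
Proof.
have [N HN] : exists N : nat, forall b, b \in s ->
    forall p, prime p -> (N <= p)%N -> padic_abs R p b <= 1.
  elim: s => [|c s [N HN]]; first by exists 0%N.
  have [N1 HN1] := padic_abs_le1 c; exists (maxn N N1) => b.
  rewrite inE => /orP [/eqP ->|bs] p pr; rewrite geq_max => /andP [h1 h2].
    exact: HN1.
  exact: HN.
exists [seq p <- iota 0 N | prime p] => b bs.
rewrite [RHS]fsbig_seq ?filter_uniq ?iota_uniq //.
apply/esym/fsbig_widen => p /=.
  by rewrite mem_filter => /andP [].
rewrite mem_filter mem_iota add0n => -[pr /negP].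
by rewrite pr /= -leqNgt => Np; apply/logmax1_le1/HN.
Qed.

Lemma local_height_ge0 b : 0 <= local_height b.
Proof.
have [r Hr] := padic_sum_finite [:: b].
rewrite /local_height Hr ?mem_head // addr_ge0 ?logmax1_ge0 //.
by apply: sumr_ge0 => p _; apply: logmax1_ge0.
Qed.

Lemma local_height_coef (s : seq algC) (k : nat) :
  local_height (\prod_(c <- s) ('X - c%:P))`_k
    <= ln 2 *+ size s + \sum_(c <- s) local_height c.
Proof.
set b := _`_k; have [r Hr] := padic_sum_finite (b :: s).
have Er c : c \in b :: s -> local_height c = logmax1 (arch_abs R c)
    + \sum_(p <- r) logmax1 (padic_abs R p c).
  by move=> cs; rewrite /local_height Hr.
rewrite Er ?mem_head // (eq_big_seq _ (fun c cs => Er c (mem_behead cs))).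
rewrite big_split /= addrA; apply: lerD.
  by apply: logmax1_coef_prod arch_quasi_abs; lra.
rewrite exchange_big /=; apply: ler_sum => p _.
apply: le_trans (logmax1_coef_prod _ _ _ (padic_quasi_abs p)) _ => //.
by rewrite ln1 mul0rn add0r.
Qed.

(** * Heights as averages over automorphisms *)

Lemma weil_heightE x (r : seq algC) :
  uniq r -> minCpoly x = \prod_(y <- r) ('X - y%:P) ->
  weil_height R x = (size r)%:R^-1 * \sum_(y <- r) local_height y.
Proof.
move=> ur Dr; rewrite /weil_height Dr size_prod_XsubC /=; congr (_ * _).
rewrite [RHS]fsbig_seq //; apply: eq_fsbigl.
by apply/seteqP; split=> y; rewrite /conjugates /= Dr root_prod_XsubC.
Qed.

Lemma weil_height_ge0 x : 0 <= weil_height R x.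
Proof.
have [r ur Dr] := minCpoly_prod_conjugates x.
rewrite (weil_heightE ur Dr) mulr_ge0 ?invr_ge0 //.
by apply: sumr_ge0 => y _; exact: local_height_ge0.
Qed.

Lemma weil_height_conj x y :
  root (minCpoly x) y -> weil_height R y = weil_height R x.
Proof.
move=> /conjugate_automorphism [nu <-].
by rewrite /weil_height /conjugates minCpoly_aut.
Qed.

(** The family N is common to all elements of s, so that inequalities between
    their heights can be proved one automorphism at a time. *)
Lemma weil_height_average (s : seq algC) :
  exists N : seq {rmorphism algC -> algC}, (0 < size N)%N /\
  forall x, x \in s ->
    weil_height R x = (size N)%:R^-1 * \sum_(nu <- N) local_height (nu x).
Proof.
have [N [N0 HN]] := automorphisms_average_conjugates s.
exists N; split=> // x xs.
have [r ur Dr] := minCpoly_prod_conjugates x.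
have [|m [sN ->]] := HN x xs R local_height r ur.
  by move=> y; rewrite Dr root_prod_XsubC.
have := N0; rewrite sN muln_gt0 => /andP [m0 r0].
rewrite (weil_heightE ur Dr) natrM -(mulr_natl (\sum_(y <- r) local_height y)).
by field; rewrite !pnatr_eq0 -!lt0n m0 r0.
Qed.

(** An automorphism nu sends the coefficients of the product over s to those of
    the product over nu(s), so the local estimate applies to each nu. *)
Lemma weil_height_coef (s : seq algC) (k : nat) :
  weil_height R (\prod_(c <- s) ('X - c%:P))`_k
    <= ln 2 *+ size s + \sum_(c <- s) weil_height R c.
Proof.
set b := _`_k; have [N [N0 HN]] := weil_height_average (b :: s).
rewrite HN ?mem_head // (eq_big_seq _ (fun c cs => HN c (mem_behead cs))).
rewrite -mulr_sumr exchange_big /= mulrC ler_pdivrMr ?ltr0n //.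
rewrite mulrDl mulrAC mulVf ?pnatr_eq0 -?lt0n // mul1r.
have -> : ln 2 *+ size s * (size N)%:R = \sum_(nu <- N) (ln 2 *+ size s) :> R.
  by rewrite big_const_seq count_predT iter_addr_0 mulr_natr.
rewrite -big_split /=; apply: ler_sum => nu _.
rewrite /b -coef_map /= map_prod_XsubC.
by have := local_height_coef (map nu s) k; rewrite big_map size_map big_map.
Qed.

End Local.

(** * Minimal polynomials over a subfield *)

(** Cancelling the leading term of M against a multiple of P over F lowers the
    degree, until the minimality of P forces the remainder to vanish. *)
Lemma is_min_poly_dvdp (F : divringClosed algC) (a : algC) (P M : {poly algC}) :
  is_min_poly F a P -> M \is a polyOver F -> root M a -> P %| M.
Proof.
move=> [PF Pmonic Pa Pmin].
have [n] := ubnP (size M); elim: n M => // n IH M; rewrite ltnS => Mn MF Ma.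
have [->|M0] := eqVneq M 0; first exact: dvdp0.
have sPM : (size P <= size M)%N by apply: Pmin.
pose T := (lead_coef M)%:P * 'X^(size M - size P) * P.
have TP : P %| T by apply: dvdp_mull.
have TF : T \is a polyOver F.
  apply: rpredM PF; apply: rpredM; last by rewrite rpredX // polyOverX.
  by rewrite polyOverC; apply: (polyOverP MF).
rewrite -[M](subrK T) dvdp_addl //.
have [/eqP ->|MT0] := boolP (M - T == 0); first exact: dvdp0.
apply: IH; last first.
- by rewrite rootE hornerD hornerN hornerM (rootP Ma) (rootP Pa) mulr0 subr0.
- exact: rpredB.
apply: leq_trans Mn.
have P0 : P != 0 by apply: monic_neq0.
have lM0 : lead_coef M != 0 by rewrite lead_coef_eq0.
have sT : size T = size M.
  rewrite /T -mulrA mul_polyC size_scale // size_monicM ?monicXn //.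
  by rewrite size_polyXn addSn /= subnK.
have lT : lead_coef T = lead_coef M.
  by rewrite /T !lead_coefM lead_coefC lead_coefXn (monicP Pmonic) !mulr1.
have le : (size (M - T)%R <= size M)%N.
  by apply: leq_trans (size_polyD _ _) _; rewrite size_polyN sT maxnn.
rewrite ltn_neqAle le andbT; apply: contraNneq MT0 => sMT.
rewrite -lead_coef_eq0 lead_coefE sMT coefB -lead_coefE -sT -lead_coefE lT.
by rewrite subrr.
Qed.

Lemma minCpoly_polyOver (F : divringClosed algC) (a : algC) :
  minCpoly a \is a polyOver F.
Proof.
have [q [-> _] _] := minCpolyP a.
by apply/polyOverP => i; rewrite coef_map rpred_rat.
Qed.

Lemma finite_roots (P : {poly algC}) : P != 0 -> finite_set [set b | root P b].
Proof.
move=> P0; have [r Dr] := closed_field_poly_normal P.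
apply/finite_seqP; exists r; apply/seteqP; split=> b /=;
  by rewrite {1}Dr rootZ ?lead_coef_eq0 // root_prod_XsubC.
Qed.

(** A polynomial of degree at most d with coefficients in A is determined by a
    function from d + 1 indices to a list of the elements of A. *)
Lemma finite_roots_bounded_degree (A : set algC) (d : nat) : finite_set A ->
  finite_set [set b | exists P : {poly algC},
    [/\ P != 0, (size P <= d.+1)%N, forall i, A P`_i & root P b]].
Proof.
move=> /finite_seqP [s DA].
pose poly_of (f : {ffun 'I_d.+1 -> 'I_(size s)}) : {poly algC} :=
  \poly_(i < d.+1) s`_(f (inord i)).
apply: (@sub_finite_set _ _ (\bigcup_(f in [set f | poly_of f != 0])
  [set b | root (poly_of f) b])).
  move=> b [P [P0 sP AP Pb]].
  have idx (i : 'I_d.+1) : (index (P`_i)%R s < size s)%N.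
    by rewrite index_mem; have := AP i; rewrite DA.
  pose f := [ffun i => Ordinal (idx i)].
  have Df : poly_of f = P.
    apply/polyP => i; rewrite coef_poly; case: ltnP => [id|di].
      by rewrite ffunE /= inordK // nth_index //; have := AP i; rewrite DA.
    by rewrite nth_default // (leq_trans sP).
  by exists f; rewrite /= Df.
by apply: bigcup_finite => [|f]; [exact: finite_finset | exact: finite_roots].
Qed.

(** * Northcott numbers *)

Section Main.
Context (R : realType).

(** The roots of P are conjugates of a over Q, so they all have the height of a.
    No bound is put on k: the zero coefficients beyond the degree of P must also
    lie in the finite set of elements of F of small height. *)
Lemma weil_height_min_poly_coef (F : divringClosed algC) (a : algC)
    (P : {poly algC}) (d k : nat) :
  is_min_poly F a P -> ((size P).-1 <= d)%N ->
  weil_height R P`_k <= d%:R * ln 2 + d%:R * weil_height R a.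
Proof.
move=> minP Pd; have [PF Pmonic _ _] := minP.
have [r] := closed_field_poly_normal P; rewrite (monicP Pmonic) scale1r => DP.
have rd : (size r <= d)%N by move: Pd; rewrite DP size_prod_XsubC.
have conj_r c : c \in r -> weil_height R c = weil_height R a.
  move=> cr; apply: weil_height_conj.
  have /dvdpP [q ->] :=
    is_min_poly_dvdp minP (minCpoly_polyOver F a) (root_minCpoly a).
  by rewrite rootM DP root_prod_XsubC cr orbT.
rewrite DP; apply: le_trans (weil_height_coef R r k) _.
rewrite (eq_big_seq _ conj_r) big_const_seq count_predT iter_addr_0.
rewrite -mulrnDl -mulrDr -(mulr_natl (ln 2 + _)) ler_wpM2r ?ler_nat //.
by rewrite addr_ge0 ?weil_height_ge0 // ln_ge0 //; lra.
Qed.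

Lemma northcott_number_le_linear (F : divringClosed algC) (d : nat) (t : R) :
  (1 <= d)%N -> 0 <= t ->
  infinite_set [set a | degree_le_over F d a /\ weil_height R a < t] ->
  (northcott_number R [set a : algC | a \in F]
     <= (d%:R * ln 2 + d%:R * t)%:E)%E.
Proof.
move=> d1 t0 Xinf; set t' := d%:R * ln 2 + d%:R * t.
apply: ge_ereal_inf; exists t'%:E => //; exists t' => //; split.
  by rewrite addr_ge0 // mulr_ge0 // ln_ge0 //; lra.
move=> /(finite_roots_bounded_degree d); apply/contra_not: Xinf.
apply: sub_finite_set => a [[P minP Pd] hat].
have [PF Pmonic Pa _] := minP; exists P; split=> //.
- exact: monic_neq0.
- by rewrite -ltnS; move: Pd; case: (size P).
move=> i; split; first exact: (polyOverP PF).
apply: le_lt_trans (weil_height_min_poly_coef i minP Pd) _.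
by rewrite ltrD2l ltr_pM2l // ltr0n.
Qed.

End Main.

Theorem theorem1p4 (R : realType) (F : divringClosed algC) (C : \bar R)
    (hC : northcott_number R [set a : algC | a \in F] = C)
    (d : nat) (hd : (1 <= d)%N) :
  ((C - (d%:R * ln 2)%:E) * ((d%:R * 2 ^+ d)^-1)%:E
     <= northcott_number R (degree_le_over F d))%E.
Proof.
apply/ereal_infP => _ [t [t0 Xinf] <-].
have := northcott_number_le_linear hd t0 Xinf; rewrite hC => Ct.
have d0 : 0 < d%:R :> R by rewrite ltr0n.
rewrite lee_pdivrMr ?mulr_gt0 ?exprn_gt0 // leeBlDr //.
apply: le_trans Ct _; rewrite -EFinM -EFinD lee_fin addrC lerD2r.
rewrite [leRHS]mulrCA ler_pM2l // ler_peMr // exprn_ege1 //; lra.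
Qed.
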